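(* Let $p_1,p_2\in[1,\infty]$ and $p\in(0,\infty]$. Put $p_3=\infty$ if $0<p\le1$ and $p_3=p'$ if $1<p\le\infty$, and define $q=q(p_1,p_2,p)$ as follows: (I) if $1/p_1,1/p_2,1/p_3\le1/2$, then $q=4$; (II) if $1/p_i,1/p_j\le1/2\le1/p_k$ for some permutation $(i,j,k)$ of $(1,2,3)$, then $q=2p_k$; (III-1) if $1/p_i\le1/2\le1/p_j,1/p_k$ and $1/p_j+1/p_k\le3/2$ for some permutation $(i,j,k)$ of $(1,2,3)$, then $1/q=(1/2)(1/p_j+1/p_k-1/2)$; (III-2) if $1/p_i\le1/2\le1/p_j,1/p_k$ and $1/p_j+1/p_k\ge3/2$ for some permutation $(i,j,k)$ of $(1,2,3)$, then $1/q=1/p_j+1/p_k-1$; (IV-1) if $1/2\le1/p_1,1/p_2,1/p_3$ and $1/p_1+1/p_2\le1+1/p_3$, $1/p_2+1/p_3\le1+1/p_1$, $1/p_3+1/p_1\le1+1/p_2$, then $1/q=(1/2)(1/p_1+1/p_2+1/p_3-1)$; (IV-2) if $1/2\le1/p_1,1/p_2,1/p_3$ and $1/p_i+1/p_j\ge1+1/p_k$ for some permutation $(i,j,k)$ of $(1,2,3)$, then $1/q=1/p_i+1/p_j-1$. Then the inclusion $$\ell^q_+(\mathbb{Z}^n\times\mathbb{Z}^n)\subset\mathcal{B}^{\,\mathrm{form}}_{\max(2,p_1'),\max(2,p_2'),\max(2,p)}(\mathbb{Z}^n\times\mathbb{Z}^n)$$ holds. Moreover, the stronger inclusion $$\ell^{q,\infty}_+(\mathbb{Z}^n\times\mathbb{Z}^n)\subset\mathcal{B}^{\,\mathrm{form}}_{\max(2,p_1'),\max(2,p_2'),\max(2,p)}(\mathbb{Z}^n\times\mathbb{Z}^n)$$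 holds in the following cases: (I) $1/p_1,1/p_2,1/p_3\le1/2$; (II$*$) $1/p_i,1/p_j\le1/2\le1/p_k<1$ for some permutation $(i,j,k)$ of $(1,2,3)$; (III-1$*$) $1/p_i\le1/2\le1/p_j,1/p_k$ and $1/p_j+1/p_k<3/2$ for some permutation $(i,j,k)$ of $(1,2,3)$; (IV-1$*$) $1/2\le1/p_1,1/p_2,1/p_3$, $1/p_1+1/p_2<1+1/p_3$, $1/p_2+1/p_3<1+1/p_1$, $1/p_3+1/p_1<1+1/p_2$, and $1/p_1+1/p_2+1/p_3\le2$.
   Context: For $r\in[1,\infty]$, $r'$ is the conjugate exponent, $1/r+1/r'=1$. For $q_1,q_2,q_3\in[1,\infty]$, $\mathcal{B}^{\,\mathrm{form}}_{q_1,q_2,q_3}(\mathbb{Z}^n\times\mathbb{Z}^n)$ is the set of nonnegative functions $V$ on $\mathbb{Z}^n\times\mathbb{Z}^n$ with $\|V\|_{\mathcal{B}^{\,\mathrm{form}}_{q_1,q_2,q_3}}<\infty$, where $$\|V\|_{\mathcal{B}^{\,\mathrm{form}}_{q_1,q_2,q_3}}=\sup\Big\{\sum_{\nu_1,\nu_2\in\mathbb{Z}^n}V(\nu_1,\nu_2)A(\nu_1)B(\nu_2)C(\nu_1+\nu_2)\Big\},$$ the supremum being over all nonnegative $A,B,C$ on $\mathbb{Z}^n$ with $\|A\|_{\ell^{q_1}}=\|B\|_{\ell^{q_2}}=\|C\|_{\ell^{q_3}}=1$. $\ell^q_+$ and $\ell^{q,\infty}_+$ denote the sets of nonnegative functions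 in $\ell^q(\mathbb{Z}^n\times\mathbb{Z}^n)$ and $\ell^{q,\infty}(\mathbb{Z}^n\times\mathbb{Z}^n)$, where for $0<q<\infty$ the space $\ell^{q,\infty}(\mathbb{K})$ ($\mathbb{K}$ countable) consists of $a=\{a_k\}_{k\in\mathbb{K}}$ with $\|a\|_{\ell^{q,\infty}}=\sup_{t>0}\{t\,(\mathrm{card}\{k\in\mathbb{K}:|a_k|>t\})^{1/q}\}<\infty$. *)

(* Defs.v *)
From HB Require Import structures.
From mathcomp Require Import all_boot all_order all_algebra.
From mathcomp Require Import all_classical all_reals all_analysis.
From mathcomp Require Import lra.

Set Implicit Arguments.
Unset Strict Implicit.
Unset Printing Implicit Defensive.

Import Order.TTheory GRing.Theory Num.Theory.
Import numFieldNormedType.Exports.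

Local Open Scope classical_set_scope.
Local Open Scope ring_scope.

Notation Zn n := 'rV[int]_n.

Section SequenceSpaces.
Context {R : realType} {T : choiceType}.
Implicit Types (a : T -> R) (q : R) (r : \bar R).

(* The library's Lnorm for the counting measure needs a measurableType, which
   Zn n is not; the value at -oo is a dummy. *)
Definition lnorm r a : \bar R :=
  match r with
  | q%:E => poweR (\esum_(k in [set: T]) (`|a k| `^ q)%:E) q^-1
  | +oo%E => ereal_sup [set `|a k|%:E | k in [set: T]]
  | -oo%E => 0%E
  end.

Definition weak_lnorm q a : \bar R :=
  ereal_sup [set (t%:E * poweR (counting [set k | (t < `|a k|)%R]) q^-1)%E
            | t in [set t : R | 0 < t]].

Definition ell_plus r : set (T -> R) :=
  [set a | (forall k, 0 <= a k) /\ (lnorm r a < +oo)%E].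

Definition weak_ell_plus q : set (T -> R) :=
  [set a | (forall k, 0 <= a k) /\ (weak_lnorm q a < +oo)%E].

End SequenceSpaces.

Section FormClass.
Context {R : realType} {n : nat}.

Definition form_norm (q1 q2 q3 : \bar R) (V : Zn n * Zn n -> R) : \bar R :=
  ereal_sup [set s | exists A B C : Zn n -> R,
    [/\ (forall nu, 0 <= A nu), (forall nu, 0 <= B nu)
      & (forall nu, 0 <= C nu)] /\
    [/\ lnorm q1 A = 1%E, lnorm q2 B = 1%E & lnorm q3 C = 1%E] /\
    s = \esum_(nu in [set: Zn n * Zn n])
          (V nu * A nu.1 * B nu.2 * C (nu.1 + nu.2))%:E].

Definition B_form (q1 q2 q3 : \bar R) : set (Zn n * Zn n -> R) :=
  [set V | (forall nu, 0 <= V nu) /\ (form_norm q1 q2 q3 V < +oo)%E].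

End FormClass.

Section Exponents.
Context {R : realType}.
Implicit Types (p : \bar R) (P : 'I_3 -> \bar R) (q : R).

Definition third_exponent p : \bar R :=
  if (p <= 1)%E then +oo%E else hoelder_conjugate p.

Definition exponents (p1 p2 p : \bar R) : 'I_3 -> \bar R :=
  tnth [tuple p1; p2; third_exponent p].

(* 1/p as a real number, with 1/oo = 0. *)
Definition rcp p : R := fine p^-1.

Local Notation "1/2" := (2^-1 : R).

Inductive exponent P q : Prop :=
| exponent_I of
    (forall i, rcp (P i) <= 1/2) &
    q = 4
| exponent_II (i j k : 'I_3) of uniq [:: i; j; k] &
    rcp (P i) <= 1/2 & rcp (P j) <= 1/2 & 1/2 <= rcp (P k) &
    q%:E = (2%:E * P k)%E
| exponent_III1 (i j k : 'I_3) of uniq [:: i; j; k] &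
    rcp (P i) <= 1/2 & 1/2 <= rcp (P j) & 1/2 <= rcp (P k) &
    rcp (P j) + rcp (P k) <= 3 / 2 &
    q^-1 = 1/2 * (rcp (P j) + rcp (P k) - 1/2)
| exponent_III2 (i j k : 'I_3) of uniq [:: i; j; k] &
    rcp (P i) <= 1/2 & 1/2 <= rcp (P j) & 1/2 <= rcp (P k) &
    3 / 2 <= rcp (P j) + rcp (P k) &
    q^-1 = rcp (P j) + rcp (P k) - 1
| exponent_IV1 of
    (forall i, 1/2 <= rcp (P i)) &
    (forall i j k : 'I_3, uniq [:: i; j; k] ->
       rcp (P i) + rcp (P j) <= 1 + rcp (P k)) &
    q^-1 = 1/2 * (\sum_i rcp (P i) - 1)
| exponent_IV2 (i j k : 'I_3) of uniq [:: i; j; k] &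
    (forall l, 1/2 <= rcp (P l)) &
    1 + rcp (P k) <= rcp (P i) + rcp (P j) &
    q^-1 = rcp (P i) + rcp (P j) - 1.

Inductive weak_case P : Prop :=
| weak_I of (forall i, rcp (P i) <= 1/2)
| weak_II (i j k : 'I_3) of uniq [:: i; j; k] &
    rcp (P i) <= 1/2 & rcp (P j) <= 1/2 & 1/2 <= rcp (P k) & rcp (P k) < 1
| weak_III1 (i j k : 'I_3) of uniq [:: i; j; k] &
    rcp (P i) <= 1/2 & 1/2 <= rcp (P j) & 1/2 <= rcp (P k) &
    rcp (P j) + rcp (P k) < 3 / 2
| weak_IV1 of
    (forall i, 1/2 <= rcp (P i)) &
    (forall i j k : 'I_3, uniq [:: i; j; k] ->
       rcp (P i) + rcp (P j) < 1 + rcp (P k)) &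
    \sum_i rcp (P i) <= 2.

Lemma exponents_ge1 (p1 p2 p : \bar R) i :
  (1 <= p1)%E -> (1 <= p2)%E -> (1 <= exponents p1 p2 p i)%E.
Proof.
move=> h1 h2.
have h3 : (1 <= third_exponent p)%E.
  rewrite /third_exponent; case: ifPn; first by rewrite leey.
  rewrite -ltNge; case: p => [r||]//=.
  rewrite lte_fin => r1.
  have r0 : r - 1 > 0 by rewrite subr_gt0.
  rewrite /hoelder_conjugate/= eqe gt_eqF ?(lt_trans _ r1)//.
  rewrite -EFinD inver gt_eqF// -EFinM lee_fin ler_pdivlMr//; lra.
rewrite /exponents; case: i => [[|[|[|//]]]] hi; by rewrite (tnth_nth 1%E).
Qed.

Lemma rcp_itv p : (1 <= p)%E -> 0 <= rcp p <= 1.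
Proof.
case: p => [r||]//=; last by rewrite /rcp /inve /= lexx ler01.
rewrite lee_fin /rcp => r1.
have r0 : 0 < r by lra.
by rewrite inver gt_eqF//= invr_ge0 ltW//= invf_le1.
Qed.

Lemma rcp_gt0 p : 0 < rcp p -> p = (rcp p)^-1%:E.
Proof.
rewrite /rcp; case: p => [r||]//=; try by rewrite /inve /= ltxx.
rewrite inver; case: eqP => [->|_] /=; first by rewrite ltxx.
by rewrite invrK.
Qed.

Local Notation o0 := (@inord 2 0).
Local Notation o1 := (@inord 2 1).
Local Notation o2 := (@inord 2 2).

Lemma ord3 (i : 'I_3) : [\/ i = o0, i = o1 | i = o2].
Proof.
case: i => [[|[|[|//]]]] hi;
  [apply: Or31|apply: Or32|apply: Or33]; by apply: val_inj; rewrite /= inordK.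
Qed.

Lemma sum3 (f : 'I_3 -> R) : \sum_i f i = f o0 + f o1 + f o2.
Proof.
rewrite !big_ord_recl big_ord0 addr0 addrA.
by congr (f _ + f _ + f _); apply: val_inj; rewrite /= inordK.
Qed.

Lemma uniq3 (i j k : 'I_3) : uniq [:: i; j; k] ->
  [\/ [/\ i = o0, j = o1 & k = o2], [/\ i = o0, j = o2 & k = o1]
    | [\/ [/\ i = o1, j = o0 & k = o2], [/\ i = o1, j = o2 & k = o0]
        | [\/ [/\ i = o2, j = o0 & k = o1] | [/\ i = o2, j = o1 & k = o0]]]].
Proof.
case: (ord3 i) => ->; case: (ord3 j) => ->; case: (ord3 k) => -> //=;
  rewrite !inE -!val_eqE /= !inordK //= => _; do ?[by apply: Or31
  |by apply: Or32|apply: Or33]; by [left|right].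
Qed.

Lemma uniq_perms : [/\ uniq [:: o0; o1; o2], uniq [:: o0; o2; o1],
  uniq [:: o1; o0; o2] & [/\ uniq [:: o1; o2; o0],
  uniq [:: o2; o0; o1] & uniq [:: o2; o1; o0]]].
Proof. by split=> //; first [split|idtac]; rewrite /= !inE -!val_eqE /= !inordK. Qed.

Lemma exponent_exists P : (forall i, 1 <= P i)%E -> exists q, exponent P q.
Proof.
move=> P1.
have [u1 u2 u3 [u4 u5 u6]] := uniq_perms.
have all3 (Q : 'I_3 -> Prop) : Q o0 -> Q o1 -> Q o2 -> forall i, Q i.
  by move=> ? ? ? i; case: (ord3 i) => ->.
have eII k : 1/2 <= rcp (P k) -> (2 / rcp (P k))%:E = (2%:E * P k)%E.
  by move=> h; rewrite [P k in RHS]rcp_gt0 ?EFinM//; lra.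
have III i j k : uniq [:: i; j; k] -> rcp (P i) <= 1/2 -> 1/2 <= rcp (P j) ->
    1/2 <= rcp (P k) -> exists q, exponent P q.
  move=> u hi hj hk.
  have [h|/ltW h] := leP (rcp (P j) + rcp (P k)) (3 / 2).
    exists (1/2 * (rcp (P j) + rcp (P k) - 1/2))^-1.
    by apply: (exponent_III1 u) => //; rewrite invrK.
  exists (rcp (P j) + rcp (P k) - 1)^-1.
  by apply: (exponent_III2 u) => //; rewrite invrK.
have IV2 i j k : uniq [:: i; j; k] -> (forall l, 1/2 <= rcp (P l)) ->
    1 + rcp (P k) <= rcp (P i) + rcp (P j) -> exists q, exponent P q.
  move=> u hl h; exists (rcp (P i) + rcp (P j) - 1)^-1.
  by apply: (exponent_IV2 u) => //; rewrite invrK.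
have [h0|/ltW h0] := leP (rcp (P o0)) (1/2);
have [h1|/ltW h1] := leP (rcp (P o1)) (1/2);
have [h2|/ltW h2] := leP (rcp (P o2)) (1/2).
- by exists 4; apply: exponent_I => //; exact: all3.
- by exists (2 / rcp (P o2)); apply: (exponent_II u1) => //; exact: eII.
- by exists (2 / rcp (P o1)); apply: (exponent_II u2) => //; exact: eII.
- exact: III u1 _ _ _.
- by exists (2 / rcp (P o0)); apply: (exponent_II u4) => //; exact: eII.
- exact: III u3 _ _ _.
- exact: III u5 _ _ _.
- have hl : forall l, 1/2 <= rcp (P l) by exact: all3.
  have [t1|/ltW t1] := leP (rcp (P o0) + rcp (P o1)) (1 + rcp (P o2)); last first.
    exact: IV2 u1 _ _.
  have [t2|/ltW t2] := leP (rcp (P o0) + rcp (P o2)) (1 + rcp (P o1)); last first.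
    exact: IV2 u2 _ _.
  have [t3|/ltW t3] := leP (rcp (P o1) + rcp (P o2)) (1 + rcp (P o0)); last first.
    exact: IV2 u4 _ _.
  exists (1/2 * (\sum_i rcp (P i) - 1))^-1.
  apply: exponent_IV1; rewrite ?invrK// => i j k.
  by move=> /uniq3[[-> -> ->]|[-> -> ->]|[[-> -> ->]|[-> -> ->]|[[-> -> ->]|[-> -> ->]]]];
    lra.
Qed.

Lemma exponent_unique P q q' : (forall i, 1 <= P i)%E ->
  exponent P q -> exponent P q' -> q = q'.
Proof.
move=> P1.
pose u i := Num.max (rcp (P i)) (1/2).
pose F := Num.max (1/2 * (u o0 + u o1 + u o2 - 1))
  (Num.max (u o0 + u o1 - 1) (Num.max (u o0 + u o2 - 1) (u o1 + u o2 - 1))).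
suff H q0 : exponent P q0 -> q0^-1 = F.
  by move=> /H h /H h'; apply: invr_inj; rewrite h h'.
have ulo i : rcp (P i) <= 1/2 -> u i = 1/2 by move=> h; rewrite /u max_r.
have uhi i : 1/2 <= rcp (P i) -> u i = rcp (P i) by move=> h; rewrite /u max_l.
have ule1 i : u i <= 1.
  by have /andP[_ h] := rcp_itv (P1 i); rewrite /u ge_max h /=; lra.
have FE (z : R) :
  [/\ 1/2 * (u o0 + u o1 + u o2 - 1) <= z, u o0 + u o1 - 1 <= z,
      u o0 + u o2 - 1 <= z & u o1 + u o2 - 1 <= z] ->
  [|| z <= 1/2 * (u o0 + u o1 + u o2 - 1), z <= u o0 + u o1 - 1,
      z <= u o0 + u o2 - 1 | z <= u o1 + u o2 - 1] -> z = F.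
  case=> z1 z2 z3 z4 h.
  by apply/eqP; rewrite eq_le !ge_max z1 z2 z3 z4 !le_max h.
clearbody F; clearbody u.
have F1 i j k z : uniq [:: i; j; k] -> u i + u j <= 1 + u k ->
    u j + u k <= 1 + u i -> u k + u i <= 1 + u j ->
    z = 1/2 * (u i + u j + u k - 1) -> z = F.
  move=> w tk ti tj hz; apply: FE.
    by case: (uniq3 w) => [[? ? ?]|[? ? ?]|[[? ? ?]|[? ? ?]|[[? ? ?]|[? ? ?]]]];
      subst i j k; clear - tk ti tj hz; split; lra.
  apply/orP; left.
  by case: (uniq3 w) => [[? ? ?]|[? ? ?]|[[? ? ?]|[? ? ?]|[[? ? ?]|[? ? ?]]]];
    subst i j k; clear - hz; lra.
have F2 i j k z : uniq [:: i; j; k] -> 1 + u k <= u i + u j ->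
    z = u i + u j - 1 -> z = F.
  move=> w tk hz; have li := ule1 i; have lj := ule1 j; apply: FE.
    by case: (uniq3 w) => [[? ? ?]|[? ? ?]|[[? ? ?]|[? ? ?]|[[? ? ?]|[? ? ?]]]];
      subst i j k; clear - tk li lj hz; split; lra.
  have E := lexx z; rewrite {2}hz in E.
  by case: (uniq3 w) => [[? ? ?]|[? ? ?]|[[? ? ?]|[? ? ?]|[[? ? ?]|[? ? ?]]]];
    subst i j k; rewrite 1?[u o1 + u o0]addrC 1?[u o2 + u o0]addrC
      1?[u o2 + u o1]addrC in E; rewrite E ?orbT.
have [y _ _ _] := uniq_perms.
case=> [h ->|i j k w hi hj hk hq|i j k w hi hj hk h hq|i j k w hi hj hk h hq
       |h t hq|i j k w h t hq].
- by apply: (F1 _ _ _ _ y); rewrite !(ulo _ (h _)); clear; lra.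
- have {}hq : q0^-1 = 1/2 * rcp (P k).
    move: hq; rewrite [P k in X in X -> _]rcp_gt0; last by clear - hk; lra.
    by rewrite -EFinM => -[->]; rewrite invfM invrK.
  have k1 := ule1 k; rewrite (uhi k hk) in k1.
  by apply: (F1 _ _ _ _ w); rewrite ?hq (ulo i hi) (ulo j hj) (uhi k hk);
    clear - hk k1; lra.
- have k1 := ule1 k; have j1 := ule1 j.
  rewrite (uhi k hk) in k1; rewrite (uhi j hj) in j1.
  by apply: (F1 _ _ _ _ w); rewrite ?hq (ulo i hi) (uhi j hj) (uhi k hk);
    clear - hj hk h k1 j1; lra.
- have w' : uniq [:: j; k; i] by rewrite -(rot_uniq 2).
  by apply: (F2 _ _ _ _ w'); rewrite ?hq (uhi j hj) (uhi k hk) ?(ulo i hi);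
    clear - h; lra.
- have [_ _ _ [y' y'' _]] := uniq_perms; rewrite sum3 in hq.
  by apply: (F1 _ _ _ _ y); rewrite ?hq !(uhi _ (h _)) //; exact: t.
- by apply: (F2 _ _ _ _ w); rewrite ?hq !(uhi _ (h _)).
Qed.

End Exponents.

(* Main.v *)
Require Import Defs.
From HB Require Import structures.
From mathcomp Require Import all_boot all_order all_algebra.
From mathcomp Require Import all_classical all_reals all_analysis.
From mathcomp Require Import lra ring zify.

Set Implicit Arguments.
Unset Strict Implicit.
Unset Printing Implicit Defensive.

Import Order.TTheory GRing.Theory Num.Theory.

Local Open Scope classical_set_scope.
Local Open Scope ring_scope.

(** Put [a_i = min (1/2, 1 - 1/p_i)].  The three indices [max (2, p_1')],
    [max (2, p_2')] and [max (2, p)] have reciprocals [a_1], [a_2] and [a_3].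
    All six cases of the definition of [q] give, with [t = 1 - 1/q],
    [t <= a_i + a_j] for every pair [i, j] and [2 t <= a_1 + a_2 + a_3]
    ([exponent_bounds]), and only these inequalities are needed.  If [A], [B],
    [C] have norm 1 then [A <= f^a_1], [B <= g^a_2], [C <= h^a_3] with [f], [g],
    [h] nonnegative of total mass at most 1 ([lnorm_submass]), so it suffices
    to bound the finite sums of [V f(nu_1)^a_1 g(nu_2)^a_2 h(nu_1 + nu_2)^a_3].
    Of the group structure one only uses that any two of [nu_1], [nu_2],
    [nu_1 + nu_2] determine the pair [(nu_1, nu_2)].

    For [V] in [l^q], the inequalities on [t] give
    [f^a_1 g^a_2 h^a_3 <= (fg + gh + fh)^t] pointwise ([powR_prod_le]), and
    [V W^t <= V^q + W] because a weighted geometric mean is at most the larger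
    entry.  Each of the products [fg], [gh], [fh] has sum at most 1, hence the
    whole sum is at most [|V|_q^q + 3] ([strong_trilinear_le]).

    For [V] in weak [l^q], the weak cases give the strict triangle inequalities
    [a_i < a_j + a_k] and [a_1 + a_2 + a_3 >= 1] ([weak_case_bounds]).  Put
    [s = (a_1 + a_2 + a_3) / 2 >= t].  The sum of [V] over a finite set [E] is
    at most a constant times [|E|^s] ([weak_sum_le]).  Rank the points in
    decreasing order of [f] and cut the ranks into dyadic blocks: the [i]-th
    block has at most [2^i] points, on it [f <= w_i / 2^i], and the [w_i <= 1]
    have sum at most 2 ([dyadic_rank]); likewise for [g] and [h].  The pairs
    lying in blocks [i], [j], [k] number at most [2^(i+j)], [2^(i+k)] and
    [2^(j+k)]; choosing the smallest of these bounds, the strict triangle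
    inequalities turn [|E|^s 2^(- i a_1 - j a_2 - k a_3)] into a kernel that
    decays geometrically in the distances between [i], [j], [k] ([kernel_le]).
    Finally [w_i^a_1 w_j^a_2 w_k^a_3 <= w_i + w_j + w_k] since the weights are
    at most 1 and [a_1 + a_2 + a_3 >= 1], and the sum over [i], [j], [k]
    converges ([weak_trilinear_le]). *)

(** * Finite sums of functions of mass at most one *)

Section FiniteSums.
Context {R : realType}.

(** A nonnegative function of total mass at most 1: every sum over finitely many
    distinct points is at most 1.  Quantifying over duplicate-free sequences
    keeps the whole argument inside finite sums of real numbers. *)
Definition submass (T : eqType) (f : T -> R) :=
  (forall x, 0 <= f x) /\ forall s, uniq s -> \sum_(x <- s) f x <= 1.

Lemma submass_le1 (T : eqType) (f : T -> R) x : submass f -> f x <= 1.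
Proof. by move=> [_ /(_ [:: x])]; rewrite big_seq1; apply. Qed.

Lemma ler_sum_subseq (T : eqType) (s t : seq T) (F : T -> R) :
  (forall x, 0 <= F x) -> uniq s -> {subset s <= t} ->
  \sum_(x <- s) F x <= \sum_(x <- t) F x.
Proof.
move=> F0; elim: s t => [|x s IH] t /=.
  by rewrite big_nil => _ _; apply: sumr_ge0.
move=> /andP[xs us] st.
have xt : x \in t by apply: st; rewrite inE eqxx.
rewrite big_cons (perm_big _ (perm_to_rem xt)) big_cons lerD2l.
apply: IH => // y ys.
have : y \in t by apply: st; rewrite inE ys orbT.
rewrite (perm_mem (perm_to_rem xt)) inE => /orP[/eqP yx|//].
by rewrite -yx ys in xs.
Qed.

(** The map [z |-> (phi z, psi z)] embeds the sum into the product of the sum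
    of [f] and the sum of [g]. *)
Lemma sum_prod_le1 (S T U : eqType) (phi : S -> T) (psi : S -> U)
    (f : T -> R) (g : U -> R) (X : seq S) :
  injective (fun z => (phi z, psi z)) -> submass f -> submass g -> uniq X ->
  \sum_(z <- X) f (phi z) * g (psi z) <= 1.
Proof.
move=> inj [f0 f1] [g0 g1] uX.
pose s := undup (map phi X); pose t := undup (map psi X).
rewrite -(big_map (fun z => (phi z, psi z)) xpredT (fun w => f w.1 * g w.2)).
apply: (@le_trans _ _ (\sum_(w <- [seq (x, y) | x <- s, y <- t]) f w.1 * g w.2)).
  apply: ler_sum_subseq; first by move=> w; apply: mulr_ge0.
    by rewrite map_inj_uniq.
  move=> w /mapP[z zX ->]; apply: allpairs_f; rewrite mem_undup;
    by apply/mapP; exists z.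
rewrite big_allpairs /=.
under eq_bigr do rewrite -mulr_sumr.
rewrite -mulr_suml -[1]mulr1.
by apply: ler_pM; rewrite ?sumr_ge0 ?f1 ?g1 ?undup_uniq.
Qed.

Lemma size_fiber_le (S T U : eqType) (phi : S -> T) (psi : S -> U)
    (X : seq S) (s : seq T) (t : seq U) :
  injective (fun z => (phi z, psi z)) -> uniq X ->
  {in X, forall z, phi z \in s} -> {in X, forall z, psi z \in t} ->
  (size X <= size s * size t)%N.
Proof.
move=> inj uX hs ht.
rewrite -(size_map (fun z => (phi z, psi z))) -(size_allpairs (fun x y => (x, y))).
apply: uniq_leq_size; first by rewrite map_inj_uniq.
by move=> w /mapP[z zX ->]; apply: allpairs_f; [exact: hs|exact: ht].
Qed.

End FiniteSums.

(** * Dyadic decomposition by rank *)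

Section Condensation.
Context {R : realType}.

(** Cauchy condensation, in a finite form. *)
Lemma condensation (v : nat -> R) (N : nat) :
  (forall l, 0 <= v l) -> {homo v : l m / (l <= m)%N >-> m <= l} ->
  \sum_(k < N.+1) 2 ^+ k * v (2 ^ k).-1 <= 2 * \sum_(l < 2 ^ N) v l.
Proof.
move=> v0 vd.
have key k : 2 ^+ k.+1 * v (2 ^ k.+1).-1 <=
    2 * \sum_(2 ^ k <= l < 2 ^ k.+1) v l.
  rewrite exprS -mulrA ler_wpM2l//.
  have -> : 2 ^+ k * v (2 ^ k.+1).-1 =
      \sum_(2 ^ k <= l < 2 ^ k.+1) v (2 ^ k.+1).-1.
    rewrite sumr_const_nat expnS mul2n -addnn addnK.
    by rewrite -[RHS]mulr_natl natrX.
  rewrite big_nat [leRHS]big_nat; apply: ler_sum => l /andP[_ hl].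
  by apply: vd; lia.
elim: N => [|N IH].
  rewrite expn0 !big_ord_recl !big_ord0 !addr0/= mul1r.
  by have := v0 0%N; lra.
rewrite big_ord_recr/=.
apply: le_trans (lerD IH (key _)) _.
rewrite -mulrDr ler_wpM2l// -!(big_mkord xpredT v).
by rewrite [leRHS](big_cat_nat (n := (2 ^ N)%N))//= leq_exp2l.
Qed.

Lemma condensation_term (v : nat -> R) (k : nat) :
  {homo v : l m / (l <= m)%N >-> m <= l} ->
  2 ^+ k * v (2 ^ k).-1 <= \sum_(l < 2 ^ k) v l.
Proof.
move=> vd.
have -> : 2 ^+ k * v (2 ^ k).-1 = \sum_(l < 2 ^ k) v (2 ^ k).-1.
  by rewrite sumr_const card_ord -[RHS]mulr_natl natrX.
by apply: ler_sum => l _; apply: vd; have := ltn_ord l; lia.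
Qed.

(** The points of [s] are ranked from 1 in decreasing order of [f]; [m x] is the
    integer part of the binary logarithm of the rank of [x], and [w k / 2 ^ k]
    is the largest value of [f] in the [k]-th block, or 0 if that block is
    empty. *)
Lemma dyadic_rank (T : eqType) (f : T -> R) (s : seq T) :
  submass f -> uniq s ->
  exists (m : T -> nat) (w : nat -> R),
    [/\ {in s, forall x, f x <= w (m x) / 2 ^+ m x},
        forall k, (size [seq x <- s | m x == k] <= 2 ^ k)%N,
        forall k, 0 <= w k <= 1
      & forall N, \sum_(k < N) w k <= 2].
Proof.
move=> fm us; have [f0 f1] := fm.
pose r := [rel x y | f y <= f x].
pose t := sort r s.
have pt : perm_eq t s by rewrite perm_sort.
have ut : uniq t by rewrite (perm_uniq pt).
have st : sorted r t by apply: sort_sorted => x y /=; exact: le_total.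
(* The decreasing rearrangement of [f] on [s], extended by zero. *)
pose v l := nth 0 (map f t) l.
have v0 l : 0 <= v l.
  rewrite /v; have [h|h] := ltnP l (size (map f t)); last by rewrite nth_default.
  by have /mapP[x _ ->] := mem_nth 0 h.
have vd : {homo v : l m / (l <= m)%N >-> m <= l}.
  move=> l m lm; rewrite {1}/v.
  have [h|h] := ltnP m (size (map f t)); last by rewrite nth_default.
  have : sorted (fun a b => b <= a) (map f t) by rewrite sorted_map.
  move/(sorted_leq_nth (rev_trans le_trans) (@lexx _ R)) => /(_ 0 l m).
  by rewrite !inE h (leq_ltn_trans lm h) => /(_ isT isT lm).
have vs N : \sum_(l < N) v l <= 1.
  apply: (@le_trans _ _ (\sum_(x <- t) f x)); last exact: f1.
  rewrite -(big_map f xpredT id)/= (big_nth 0) -(big_mkord xpredT v).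
  rewrite (big_nat_widenl _ 0)//.
  have [h|h] := leqP N (size (map f t)).
    by rewrite [leRHS](big_cat_nat (n := N))//= lerDl; apply: sumr_ge0.
  rewrite (big_cat_nat (n := size (map f t)))//=; last exact: ltnW.
  rewrite [X in _ + X]big1_seq ?addr0// => l; rewrite mem_index_iota.
  by move=> /andP[_ /andP[hl _]]; rewrite /v nth_default.
(* The index in [t] starts at 0, so the rank is its successor and the [k]-th
   block starts at index [2 ^ k - 1]. *)
exists (fun x => trunc_log 2 (index x t).+1), (fun k => 2 ^+ k * v (2 ^ k).-1).
split=> [x xs|k|k|N].
- have xt : x \in t by rewrite (perm_mem pt).
  set k := trunc_log _ _.
  rewrite mulrC mulKf ?expf_neq0 ?pnatr_eq0//.
  have -> : f x = v (index x t).
    by rewrite /v (nth_map x) ?index_mem// nth_index.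
  by apply: vd; have := @trunc_logP 2 (index x t).+1 isT isT; rewrite -/k; lia.
- rewrite -(size_map (index^~ t)) -[leqRHS](size_iota (2 ^ k).-1).
  apply: uniq_leq_size.
    rewrite map_inj_in_uniq ?filter_uniq// => x y.
    rewrite !mem_filter => /andP[_ xs] /andP[_ ys] /(congr1 (nth x t)).
    by rewrite !nth_index ?(perm_mem pt).
  move=> _ /mapP[x + ->]; rewrite mem_filter => /andP[/eqP <- _].
  rewrite mem_iota; set l := index x t.
  have /= := @trunc_log_bounds 2 l.+1 isT isT; rewrite expnS; lia.
- rewrite mulr_ge0 ?exprn_ge0//=.
  exact: le_trans (condensation_term _ vd) (vs _).
- case: N => [|N]; first by rewrite big_ord0.
  apply: le_trans (condensation _ v0 vd) _.
  by have := vs (2 ^ N)%N; lra.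
Qed.

End Condensation.

(** * Sums of weakly summable functions *)

Section WeakSums.
Context {R : realType}.

(** A concave power lies below its tangent at 1. *)
Lemma powR_tangent_le (y s : R) : 0 <= y -> 0 < s <= 1 -> y `^ s <= 1 - s + s * y.
Proof.
move=> y0 /andP[s0]; rewrite le_eqVlt => /predU1P[->|s1].
  by rewrite powRr1//; lra.
have t0 : 0 < 1 - s by lra.
have := @conjugate_powR R (y `^ s) 1 s^-1 (1 - s)^-1 (powR_ge0 _ _) ler01.
rewrite !invr_gt0 !invrK => /(_ s0 t0).
rewrite -powRrM mulfV ?gt_eqF// powRr1// powR1 mulr1 mul1r => h.
by have := h ltac:(lra); lra.
Qed.

Lemma powR_succ_sub_ge (n : nat) (s : R) : 0 < s <= 1 ->
  s / n.+1%:R `^ (1 - s) <= n.+1%:R `^ s - n%:R `^ s.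
Proof.
move=> hs; have /andP[s0 s1] := hs.
pose N : R := n.+1%:R; have N0 : 0 < N by rewrite ltr0n.
have y0 : 0 <= n%:R / N by rewrite divr_ge0// ltW.
have h := powR_tangent_le y0 hs.
have -> : (n%:R : R) = N * (n%:R / N) by rewrite mulrC divfK ?gt_eqF.
rewrite -/N (powRM _ (ltW N0) y0).
have Ns0 : 0 < N `^ s by exact: powR_gt0.
have -> : s / N `^ (1 - s) = N `^ s * (s / N).
  rewrite -powRN -[N^-1]powR_inv1; last exact: ltW.
  rewrite mulrCA -powRD; last by rewrite lt0r_neq0 ?implybT.
  by congr (_ * _ `^ _); ring.
rewrite -[X in _ <= X - _]mulr1 -mulrBr ler_pM2l//.
apply: le_trans (lerB (lexx _) h).
have -> : n%:R / N = 1 - N^-1.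
  apply: (mulIf (lt0r_neq0 N0)); rewrite divfK ?gt_eqF// mulrBl mul1r mulVf ?gt_eqF//.
  by rewrite /N -natr1; ring.
by rewrite mulrBr mulr1 le_eqVlt; apply/orP; left; apply/eqP; ring.
Qed.

Lemma exists_min (T : eqType) (V : T -> R) (E : seq T) : E != [::] ->
  exists2 x, x \in E & {in E, forall y, V x <= V y}.
Proof.
elim: E => // x [|x' E] IH _.
  by exists x; rewrite ?mem_seq1// => y; rewrite inE => /eqP->.
have [//|z zE hz] := IH.
have [h|h] := leP (V x) (V z).
  exists x; rewrite ?mem_head// => y; rewrite inE => /orP[/eqP->//|/hz].
  exact: le_trans.
exists z; first by rewrite inE zE orbT.
by move=> y; rewrite inE => /orP[/eqP->|/hz//]; exact: ltW.
Qed.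

(** The hypothesis says that the smallest of [N] values of [V] is at most
    [M N^(s-1)], which is what the weak norm controls.  The sum is bounded by
    removing the smallest value and comparing [N^(s-1)] with the increment of
    [N^s / s]. *)
Lemma weak_sum_le (T : eqType) (V : T -> R) (M s : R) : 0 <= M -> 0 < s <= 1 ->
  (forall E x, uniq E -> x \in E -> {in E, forall y, V x <= V y} ->
     V x * (size E)%:R `^ (1 - s) <= M) ->
  forall E, uniq E -> \sum_(x <- E) V x <= M / s * (size E)%:R `^ s.
Proof.
move=> M_ge0 hs hV E; have /andP[s0 s1] := hs.
have [n] := ubnP (size E); elim: n E => // n IH E En uE.
have [->|E0] := eqVneq E [::].
  by rewrite big_nil/= powR0 ?gt_eqF// mulr0.
have [x xE hx] := exists_min V E0.
have M0 : V x * (size E)%:R `^ (1 - s) <= M by exact: hV.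
have sE : size E = (size (rem x E)).+1.
  by rewrite (perm_size (perm_to_rem xE)).
rewrite (perm_big _ (perm_to_rem xE)) big_cons.
have h1 : \sum_(y <- rem x E) V y <= M / s * (size (rem x E))%:R `^ s.
  by apply: IH; rewrite ?rem_uniq// -ltnS -sE.
have h2 := powR_succ_sub_ge (size (rem x E)) hs.
rewrite -sE in h2; rewrite sE in M0 *.
set N : R := (size _).+1%:R in M0 *; set m := size _ in h1 *.
have N0 : 0 < N `^ (1 - s) by apply: powR_gt0; rewrite ltr0n.
have M1 : V x <= M / N `^ (1 - s) by rewrite ler_pdivlMr.
have : M / N `^ (1 - s) <= M / s * (N `^ s - m%:R `^ s).
  have -> : M / N `^ (1 - s) = M / s * (s / N `^ (1 - s)).
    by rewrite mulrA divfK ?gt_eqF.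
  apply: ler_wpM2l; first by rewrite divr_ge0// ltW.
  by rewrite /N /m -sE.
rewrite mulrBr => h3; apply: le_trans (lerD M1 h1) _; lra.
Qed.

End WeakSums.

(** * The off-diagonal kernel *)

Section Kernel.
Context {R : realType}.

(** The distance [|i - j|], as a sum of two truncated differences. *)
Definition gap (i j : nat) : nat := (i - j) + (j - i).

Lemma gapC i j : gap i j = gap j i.
Proof. by rewrite /gap addnC. Qed.

Lemma sum_geometric_le (r : R) (N : nat) : 0 <= r < 1 ->
  \sum_(j < N) r ^+ j <= (1 - r)^-1.
Proof.
move=> /andP[r0 r1].
have h : 0 < 1 - r by lra.
rewrite -[leRHS]mul1r ler_pdivlMr// mulrC -opprB mulNr -subrX1.
by rewrite opprB gerBl exprn_ge0.
Qed.

Lemma sum_gap_le (r : R) (i N : nat) : 0 <= r < 1 ->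
  \sum_(j < N) r ^+ gap i j <= 2 / (1 - r).
Proof.
move=> r01; have /andP[r0 r1] := r01.
(* The indices on either side of [i] each contribute a geometric sum; in this
   form the bound can be shifted along the diagonal. *)
suff h : \sum_(j < N) r ^+ gap i j <= \sum_(j < i) r ^+ j.+1 + (1 - r)^-1.
  apply: le_trans h _; rewrite mulr_natl mulr2n lerD2r.
  apply: le_trans (sum_geometric_le i r01); apply: ler_sum => j _.
  by rewrite exprS ler_piMl ?exprn_ge0// ltW.
elim: i N => [|i IH] N.
  rewrite big_ord0 add0r; apply: le_trans (sum_geometric_le N r01).
  by apply: ler_sum => j _; rewrite /gap sub0n subn0 add0n.
case: N => [|N].
  rewrite big_ord0 addr_ge0 ?invr_ge0; [| |lra]; last first.
    by apply: sumr_ge0 => j _; rewrite exprn_ge0.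
  by [].
rewrite big_ord_recl [in leRHS]big_ord_recr/= [leLHS]addrC [leRHS]addrAC.
by apply: lerD; [exact: IH|rewrite /gap subn0 sub0n addn0].
Qed.

Lemma sum_gap_weight_le (r : R) (w : nat -> R) (N : nat) : 0 <= r < 1 ->
  (forall k, 0 <= w k) -> \sum_(k < N) w k <= 2 ->
  \sum_(i < N) \sum_(j < N) \sum_(k < N) w i * (r ^+ gap i j * r ^+ gap i k)
    <= 2 * (2 / (1 - r)) ^+ 2.
Proof.
move=> r01 w0 ws; have /andP[r0 r1] := r01.
pose C := 2 / (1 - r).
have C0 : 0 <= C by rewrite divr_ge0//; lra.
apply: le_trans (ler_wpM2r (exprn_ge0 2 C0) ws); rewrite mulr_suml.
apply: ler_sum => i _.
under eq_bigr do under eq_bigr do rewrite mulrA.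
under eq_bigr do rewrite -mulr_sumr.
rewrite -mulr_suml -mulr_sumr -mulrA ler_wpM2l// expr2.
by apply: ler_pM; rewrite ?sum_gap_le// sumr_ge0// => k _; rewrite exprn_ge0.
Qed.

(** The number [2^(i a1 + j a2 + k a3)] is the product of [2^(j+k)], [2^(i+k)],
    [2^(i+j)] raised to [s - a1], [s - a2], [s - a3].  These exponents add up to
    [s] and are at least [d], so the [s]-th power of the smallest of the three
    numbers is below that product by a factor exponential in the gaps. *)
Lemma kernel_le (a1 a2 a3 s d : R) (i j k e : nat) :
  0 <= s -> 0 <= d -> a1 + d <= s -> a2 + d <= s -> a3 + d <= s ->
  a1 + a2 + a3 = 2 * s ->
  (e <= 2 ^ i * 2 ^ j)%N -> (e <= 2 ^ i * 2 ^ k)%N -> (e <= 2 ^ j * 2 ^ k)%N ->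
  e%:R `^ s <= (2 ^+ i) `^ a1 * (2 ^+ j) `^ a2 * (2 ^+ k) `^ a3 *
    (2 `^ (- (d / 2))) ^+ (gap i j + gap j k + gap i k) :> R.
Proof.
move=> s0 d0 h1 h2 h3 hs eij eik ejk.
have p2 n : (2 : R) ^+ n = 2 `^ n%:R by rewrite powR_mulrn.
have E m : (e <= 2 ^ m)%N -> e%:R `^ s <= 2 `^ (m%:R * s) :> R.
  move=> em; rewrite powRrM -p2 -natrX; apply: ge0_ler_powR => //;
    by rewrite ?nnegrE ?ler_nat.
have pD u v : 2 `^ u * 2 `^ v = 2 `^ (u + v) :> R.
  by rewrite powRD// (pnatr_eq0 R 2) implybT.
rewrite -(powR_mulrn _ (powR_ge0 2 _)) !p2 -!powRrM !pD.
pose x : R := i%:R; pose y : R := j%:R; pose z : R := k%:R.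
have key m : (e <= 2 ^ m)%N -> m%:R * s <=
    x * a1 + y * a2 + z * a3 + - (d / 2) * (gap i j + gap j k + gap i k)%:R ->
    e%:R `^ s <= 2 `^ (x * a1 + y * a2 + z * a3 +
      - (d / 2) * (gap i j + gap j k + gap i k)%:R).
  by move=> /E em h; apply: le_trans em (ler_powR _ h); rewrite ler1n.
rewrite -!expnD in eij eik ejk.
(* For the largest index, say k, the gaps add up to at most twice
   (k - i) + (k - j). *)
have [[ki kj]|[[ij ik]|[ji jk]]] : ((i <= k /\ j <= k) \/ ((j <= i /\ k <= i) \/
  (i <= j /\ k <= j)))%N by lia.
- apply: (key _ eij).
  have g : (gap i j + gap j k + gap i k)%:R <= 2 * ((z - x) + (z - y)) :> R.
    rewrite -!natrB// -natrD -natrM ler_nat /gap; lia.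
  have xz : x <= z by rewrite ler_nat.
  have yz : y <= z by rewrite ler_nat.
  rewrite natrD -/x -/y; clearbody x y z.
  set G := _%:R in g *.
  have := ler_wpM2l d0 g.
  have : 0 <= (z - x) * (s - a1 - d) by apply: mulr_ge0; lra.
  have : 0 <= (z - y) * (s - a2 - d) by apply: mulr_ge0; lra.
  have -> : a3 = 2 * s - a1 - a2 by lra.
  clearbody G; clear -d0; nra.
- apply: (key _ ejk).
  have g : (gap i j + gap j k + gap i k)%:R <= 2 * ((x - y) + (x - z)) :> R.
    rewrite -!natrB// -natrD -natrM ler_nat /gap; lia.
  have yx : y <= x by rewrite ler_nat.
  have zx : z <= x by rewrite ler_nat.
  rewrite natrD -/y -/z; clearbody x y z.
  set G := _%:R in g *.
  have := ler_wpM2l d0 g.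
  have : 0 <= (x - y) * (s - a2 - d) by apply: mulr_ge0; lra.
  have : 0 <= (x - z) * (s - a3 - d) by apply: mulr_ge0; lra.
  have -> : a1 = 2 * s - a2 - a3 by lra.
  clearbody G; clear -d0; nra.
- apply: (key _ eik).
  have g : (gap i j + gap j k + gap i k)%:R <= 2 * ((y - x) + (y - z)) :> R.
    rewrite -!natrB// -natrD -natrM ler_nat /gap; lia.
  have xy : x <= y by rewrite ler_nat.
  have zy : z <= y by rewrite ler_nat.
  rewrite natrD -/x -/z; clearbody x y z.
  set G := _%:R in g *.
  have := ler_wpM2l d0 g.
  have : 0 <= (y - x) * (s - a1 - d) by apply: mulr_ge0; lra.
  have : 0 <= (y - z) * (s - a3 - d) by apply: mulr_ge0; lra.
  have -> : a2 = 2 * s - a1 - a3 by lra.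
  clearbody G; clear -d0; nra.
Qed.

End Kernel.

(** * Pointwise inequalities between powers *)

Section Trilinear.
Context {R : realType}.

Lemma powR_le_self (x r : R) : 0 <= x <= 1 -> 1 <= r -> x `^ r <= x.
Proof.
move=> /andP[]; rewrite le_eqVlt => /predU1P[<- _ r1|x0 x1 r1].
  by rewrite powR0// gt_eqF// (lt_le_trans ltr01).
by apply: ge1r_powR => //; rewrite x0.
Qed.

Lemma powR_prod_le_sum (a b c x y z : R) :
  0 <= x <= 1 -> 0 <= y <= 1 -> 0 <= z <= 1 ->
  0 <= a -> 0 <= b -> 0 <= c -> 1 <= a + b + c ->
  x `^ a * y `^ b * z `^ c <= x + y + z.
Proof.
move=> /andP[x0 x1] /andP[y0 y1] /andP[z0 z1] a0 b0 c0 abc.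
pose m := Num.max x (Num.max y z).
have m0 : 0 <= m by rewrite !le_max x0.
have mono u t : 0 <= u -> 0 <= t -> t <= m -> t `^ u <= m `^ u.
  by move=> u0 t0 tm; apply: ge0_ler_powR.
apply: (@le_trans _ _ m); last by rewrite !ge_max; apply/and3P; split; lra.
apply: (@le_trans _ _ (m `^ (a + b + c))); last first.
  by apply: powR_le_self => //; rewrite m0 !ge_max x1 y1.
have [ab0|ab] := eqVneq (a + b) 0.
  have -> : a = 0 by lra.
  have -> : b = 0 by lra.
  by rewrite !powRr0 !mul1r !add0r mono// !le_max lexx !orbT.
rewrite !powRD; last 2 first.
- by rewrite (negbTE ab).
- by rewrite gt_eqF// (lt_le_trans ltr01).
by rewrite !ler_pM ?mulr_ge0 ?powR_ge0 ?mono ?le_max ?lexx ?orbT.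
Qed.

(** Moving exponent from a smaller to a larger base increases the product.  Moving
    all of [c] to [y] and then the part of [b + c] beyond [s] to [x] leaves
    [y `^ s] and at least [s] on [x], and [x <= 1]. *)
Lemma powR_prod_ordered_le (a b c s x y z : R) :
  0 <= z -> z <= y -> y <= x -> x <= 1 ->
  0 <= a -> 0 <= b -> 0 <= c -> 0 <= s ->
  s <= b + c -> 2 * s <= a + b + c ->
  x `^ a * y `^ b * z `^ c <= (x * y) `^ s.
Proof.
move=> z0 zy yx x1 a0 b0 c0 s0 h1 h2.
have y0 : 0 <= y by lra.
have x0 : 0 <= x by lra.
(* Here [0 `^ 0 = 1], so a vanishing base needs care. *)
have [y_eq0|yn0] := eqVneq y 0.
  have -> : z = 0 by lra.
  rewrite y_eq0 mulr0.
  have [b_eq0|bn0] := eqVneq b 0; have [c_eq0|cn0] := eqVneq c 0.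
  - have -> : s = 0 by lra.
    by rewrite b_eq0 c_eq0 !powRr0 !mulr1 (le_trans (ge0_ler_powR a0 _ _ x1)) ?nnegrE ?powR1.
  - by rewrite (powR0 cn0) mulr0 powR_ge0.
  - by rewrite (powR0 bn0) mulr0 mul0r powR_ge0.
  - by rewrite (powR0 bn0) mulr0 mul0r powR_ge0.
have yp : 0 < y by rewrite lt_neqAle eq_sym yn0.
have xp : 0 < x by lra.
have pD t u v : 0 < t -> t `^ u * t `^ v = t `^ (u + v).
  by move=> t0; rewrite powRD// (gt_eqF t0) implybT.
rewrite powRM//.
apply: (@le_trans _ _ (x `^ a * (y `^ s * x `^ (b + c - s)))).
  rewrite -mulrA ler_wpM2l ?powR_ge0//.
  apply: (@le_trans _ _ (y `^ s * y `^ (b + c - s))).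
    rewrite pD// (_ : s + (b + c - s) = b + c); last by ring.
    by rewrite -pD// ler_wpM2l ?powR_ge0// ge0_ler_powR.
  by rewrite ler_wpM2l ?powR_ge0// ge0_ler_powR// ?nnegrE//; lra.
rewrite mulrCA [leRHS]mulrC ler_wpM2l ?powR_ge0// pD// ger_powR// ?xp//.
lra.
Qed.

Lemma powR_prod_le (a b c s x y z : R) :
  0 <= x <= 1 -> 0 <= y <= 1 -> 0 <= z <= 1 ->
  0 <= a -> 0 <= b -> 0 <= c -> 0 <= s ->
  s <= a + b -> s <= b + c -> s <= a + c -> 2 * s <= a + b + c ->
  x `^ a * y `^ b * z `^ c <= (x * y + y * z + x * z) `^ s.
Proof.
move=> /andP[x0 x1] /andP[y0 y1] /andP[z0 z1] a0 b0 c0 s0 ab bc ac abc.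
have xy0 := mulr_ge0 x0 y0; have yz0 := mulr_ge0 y0 z0.
have xz0 := mulr_ge0 x0 z0.
have up t : 0 <= t -> t <= x * y + y * z + x * z ->
    t `^ s <= (x * y + y * z + x * z) `^ s.
  by move=> t0 ht; apply: ge0_ler_powR; rewrite // nnegrE; lra.
have [yx|/ltW xy] := leP y x; have [zy|/ltW yz] := leP z y;
  have [zx|/ltW xz] := leP z x.
- by apply: le_trans (up (x * y) _ _); [apply: powR_prod_ordered_le| |lra].
- by apply: le_trans (up (x * y) _ _); [apply: powR_prod_ordered_le; lra| |lra].
- rewrite mulrAC; apply: le_trans (up (x * z) _ _); [|by []|lra].
  by apply: powR_prod_ordered_le => //; lra.
- rewrite mulrC mulrA; apply: le_trans (up (z * x) _ _); [|lra|lra].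
  by apply: powR_prod_ordered_le => //; lra.
- rewrite [X in X * _]mulrC; apply: le_trans (up (y * x) _ _); [|lra|lra].
  by apply: powR_prod_ordered_le => //; lra.
- rewrite -mulrA mulrC; apply: le_trans (up (y * z) _ _); [|lra|lra].
  by apply: powR_prod_ordered_le => //; lra.
- rewrite [X in X * _]mulrC; apply: le_trans (up (y * x) _ _); [|lra|lra].
  by apply: powR_prod_ordered_le => //; lra.
- rewrite mulrC [X in _ * X]mulrC mulrA.
  apply: le_trans (up (z * y) _ _); [|lra|lra].
  by apply: powR_prod_ordered_le => //; lra.
Qed.

(** Young's inequality without its constants: with [V = (V^q)^(1/q)], the left
    side is a weighted geometric mean of [V^q] and [P]. *)
Lemma mul_powR_le_add (V P q : R) : 0 <= V -> 0 <= P -> 1 <= q ->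
  V * P `^ (1 - q^-1) <= V `^ q + P.
Proof.
move=> V0 P0 q1; have q0 : 0 < q by lra.
have iq : 0 <= 1 - q^-1 by rewrite subr_ge0 invf_le1.
have VE : (V `^ q) `^ q^-1 = V by rewrite -powRrM mulfV ?gt_eqF// powRr1.
rewrite -[X in X * _]VE.
have pp t : 0 <= t -> t `^ q^-1 * t `^ (1 - q^-1) = t.
  move=> t0; rewrite -powRD; last by rewrite addrC subrK oner_eq0.
  by rewrite addrC subrK powRr1.
have [h|/ltW h] := leP P (V `^ q).
  apply: (@le_trans _ _ (V `^ q)); last by rewrite lerDl.
  rewrite -[leRHS]pp ?powR_ge0// ler_wpM2l ?powR_ge0//.
  by apply: ge0_ler_powR; rewrite ?nnegrE ?powR_ge0.
apply: (@le_trans _ _ P); last by rewrite lerDr powR_ge0.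
rewrite -[leRHS]pp// ler_wpM2r ?powR_ge0//.
by apply: ge0_ler_powR; rewrite ?nnegrE ?powR_ge0// invr_ge0 ltW.
Qed.

(** * Trilinear sums *)

(** Any two of [phi1], [phi2], [phi3] determine the point of [S]. *)
Section Bounds.
Variables (S T : eqType) (phi1 phi2 phi3 : S -> T).
Hypotheses (inj12 : injective (fun z => (phi1 z, phi2 z)))
  (inj23 : injective (fun z => (phi2 z, phi3 z)))
  (inj13 : injective (fun z => (phi1 z, phi3 z))).
Variables (f g h : T -> R).
Hypotheses (fm : submass f) (gm : submass g) (hm : submass h).

(** The bound for [V] in [l^q]. *)
Lemma strong_trilinear_le (V : S -> R) (q a b c : R) (X : seq S) :
  (forall z, 0 <= V z) -> 1 <= q -> 0 <= a -> 0 <= b -> 0 <= c ->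
  1 - q^-1 <= a + b -> 1 - q^-1 <= b + c -> 1 - q^-1 <= a + c ->
  2 * (1 - q^-1) <= a + b + c -> uniq X ->
  \sum_(z <- X) V z * (f (phi1 z) `^ a * g (phi2 z) `^ b * h (phi3 z) `^ c)
    <= \sum_(z <- X) V z `^ q + 3.
Proof.
move=> V0 q1 a0 b0 c0 ab bc ac abc uX.
have s0 : 0 <= 1 - q^-1 by rewrite subr_ge0 invf_le1; lra.
have [f0 _] := fm; have [g0 _] := gm; have [h0 _] := hm.
have s12 := sum_prod_le1 inj12 fm gm uX.
have s23 := sum_prod_le1 inj23 gm hm uX.
have s13 := sum_prod_le1 inj13 fm hm uX.
apply: (@le_trans _ _ (\sum_(z <- X) V z `^ q +
  (\sum_(z <- X) f (phi1 z) * g (phi2 z) + \sum_(z <- X) g (phi2 z) * h (phi3 z)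
   + \sum_(z <- X) f (phi1 z) * h (phi3 z)))); last by rewrite lerD2l; lra.
rewrite -!big_split /=; apply: ler_sum => z _.
apply: le_trans (mul_powR_le_add (V0 z) _ q1); last first.
  by rewrite !addr_ge0 ?mulr_ge0.
rewrite ler_wpM2l// powR_prod_le//; apply/andP; split => //; exact: submass_le1.
Qed.

(** The bound when the sum of [V] over [N] points is [O (N^s)], which holds for
    [V] in weak [l^q] when [1 - 1/q <= s]. *)
Lemma weak_trilinear_le (V : S -> R) (K a b c s d : R) (X : seq S) :
  0 <= K -> (forall z, 0 <= V z) ->
  (forall E, uniq E -> \sum_(z <- E) V z <= K * (size E)%:R `^ s) ->
  0 <= a -> 0 <= b -> 0 <= c -> 0 < d ->
  a + d <= s -> b + d <= s -> c + d <= s -> a + b + c = 2 * s ->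
  1 <= a + b + c -> uniq X ->
  \sum_(z <- X) V z * (f (phi1 z) `^ a * g (phi2 z) `^ b * h (phi3 z) `^ c)
    <= K * (6 * (2 / (1 - 2 `^ (- (d / 2)))) ^+ 2).
Proof.
move=> K0 V0 VK a0 b0 c0 d0 ads bds cds abcs abc1 uX.
have s0 : 0 <= s by lra.
pose X1 := undup (map phi1 X); pose X2 := undup (map phi2 X).
pose X3 := undup (map phi3 X).
have [m1 [w1 [fw1 sz1 w1_01 sw1]]] := dyadic_rank fm (undup_uniq (map phi1 X)).
have [m2 [w2 [fw2 sz2 w2_01 sw2]]] := dyadic_rank gm (undup_uniq (map phi2 X)).
have [m3 [w3 [fw3 sz3 w3_01 sw3]]] := dyadic_rank hm (undup_uniq (map phi3 X)).
rewrite -/X1 -/X2 -/X3 in fw1 sz1 fw2 sz2 fw3 sz3.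
have in1 z : z \in X -> phi1 z \in X1.
  by move=> zX; rewrite mem_undup map_f.
have in2 z : z \in X -> phi2 z \in X2.
  by move=> zX; rewrite mem_undup map_f.
have in3 z : z \in X -> phi3 z \in X3.
  by move=> zX; rewrite mem_undup map_f.
pose r : R := 2 `^ (- (d / 2)).
have r01 : 0 <= r < 1.
  rewrite powR_ge0/= /r powRN invf_lt1 ?powR_gt0//.
  by rewrite -[ltLHS](powRr0 2) /powR (pnatr_eq0 R 2)/= ltr_expR ltr_pM2r ?ln_gt0 ?ltr1n//; lra.
have /andP[r0 r1] := r01.
(* A crude common bound for the block indices that occur. *)
pose N := (\sum_(z <- X) (m1 (phi1 z) + m2 (phi2 z) + m3 (phi3 z))).+1%N.
have mN z : z \in X -> [/\ m1 (phi1 z) < N, m2 (phi2 z) < N & m3 (phi3 z) < N]%N.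
  move=> zX; rewrite /N (perm_big _ (perm_to_rem zX)) big_cons /=.
  move: (m1 _) (m2 _) (m3 _) (\sum_(_ <- _) _)%N => n1 n2 n3 n4.
  by clear; split; lia.
pose p z : 'I_N * 'I_N * 'I_N :=
  (inord (m1 (phi1 z)), inord (m2 (phi2 z)), inord (m3 (phi3 z))).
pose F z := V z * (f (phi1 z) `^ a * g (phi2 z) `^ b * h (phi3 z) `^ c).
pose B (t : 'I_N * 'I_N * 'I_N) := K * ((w1 t.1.1 + w2 t.1.2 + w3 t.2) *
  r ^+ (gap t.1.1 t.1.2 + gap t.1.2 t.2 + gap t.1.1 t.2)).
(* The contribution of the points in the blocks of indices [t]. *)
have cell t : \sum_(z <- X | p z == t) F z <= B t.
  case: t => [[i j] k]; rewrite -big_filter.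
  set E := [seq z <- X | _].
  have EX z : z \in E ->
    [/\ z \in X, m1 (phi1 z) = i, m2 (phi2 z) = j & m3 (phi3 z) = k].
    rewrite mem_filter => /andP[/eqP[<- <- <-] zX].
    by have [? ? ?] := mN _ zX; rewrite !inordK.
  have uE : uniq E by rewrite filter_uniq.
  pose D := (w1 i / 2 ^+ i) `^ a * (w2 j / 2 ^+ j) `^ b * (w3 k / 2 ^+ k) `^ c.
  have [f0 _] := fm; have [g0 _] := gm; have [h0 _] := hm.
  have wp (w : R) n : 0 <= w <= 1 -> 0 <= w / 2 ^+ n.
    by move=> /andP[w0 _]; rewrite divr_ge0// exprn_ge0.
  have step1 : \sum_(z <- E) F z <= (\sum_(z <- E) V z) * D.
    rewrite /D mulr_suml big_seq [leRHS]big_seq; apply: ler_sum => z zE.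
    have [zX <- <- <-] := EX _ zE.
    rewrite /F ler_wpM2l// !ler_pM ?mulr_ge0 ?powR_ge0//;
      apply: ge0_ler_powR; rewrite ?nnegrE ?wp//.
    - by apply: fw1; apply: in1.
    - by apply: fw2; apply: in2.
    - by apply: fw3; apply: in3.
  have D0 : 0 <= D by rewrite !mulr_ge0// powR_ge0.
  apply: le_trans step1 (le_trans (ler_wpM2r D0 (VK _ uE)) _).
  rewrite /B /= -mulrA ler_wpM2l//.
  have i12 : (size E <= 2 ^ i * 2 ^ j)%N.
    apply: leq_trans (leq_mul (sz1 i) (sz2 j)); apply: (size_fiber_le inj12 uE).
      by move=> z /EX[zX ? _ _]; rewrite mem_filter in1// andbT; apply/eqP.
    by move=> z /EX[zX _ ? _]; rewrite mem_filter in2// andbT; apply/eqP.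
  have i13 : (size E <= 2 ^ i * 2 ^ k)%N.
    apply: leq_trans (leq_mul (sz1 i) (sz3 k)); apply: (size_fiber_le inj13 uE).
      by move=> z /EX[zX ? _ _]; rewrite mem_filter in1// andbT; apply/eqP.
    by move=> z /EX[zX _ _ ?]; rewrite mem_filter in3// andbT; apply/eqP.
  have i23 : (size E <= 2 ^ j * 2 ^ k)%N.
    apply: leq_trans (leq_mul (sz2 j) (sz3 k)); apply: (size_fiber_le inj23 uE).
      by move=> z /EX[zX _ ? _]; rewrite mem_filter in2// andbT; apply/eqP.
    by move=> z /EX[zX _ _ ?]; rewrite mem_filter in3// andbT; apply/eqP.
  have := kernel_le s0 (ltW d0) ads bds cds abcs i12 i13 i23.
  rewrite -/r => ker; apply: le_trans (ler_wpM2r D0 ker) _.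
  have W := powR_prod_le_sum (w1_01 i) (w2_01 j) (w3_01 k) a0 b0 c0 abc1.
  have pdiv (w u : R) n : 0 <= w <= 1 ->
      (w / 2 ^+ n) `^ u = w `^ u / (2 ^+ n) `^ u.
    move=> /andP[w0 _]; rewrite powRM// ?invr_ge0 ?exprn_ge0//.
    by rewrite -[(2 ^+ n)^-1]powR_inv1 ?exprn_ge0// powRAC powR_inv1 ?powR_ge0.
  have pn0 (u : R) n : (2 ^+ n) `^ u != 0 :> R.
    by rewrite gt_eqF// powR_gt0// exprn_gt0.
  rewrite /D !pdiv//.
  set P := r ^+ _.
  have P0 : 0 <= P by rewrite exprn_ge0.
  apply: le_trans (ler_wpM2r P0 W).
  rewrite le_eqVlt; apply/orP; left; apply/eqP.
  by field; rewrite !pn0.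
rewrite -/F.
have -> : \sum_(z <- X) F z = \sum_t \sum_(z <- X | p z == t) F z.
  by rewrite (partition_big p xpredT).
apply: le_trans (ler_sum _ (fun t _ => cell t)) _.
rewrite -mulr_sumr ler_wpM2l//.
rewrite -(pair_big xpredT xpredT (fun (ij : 'I_N * 'I_N) (k : 'I_N) => (w1 ij.1 + w2 ij.2 + w3 k) *
  r ^+ (gap ij.1 ij.2 + gap ij.2 k + gap ij.1 k)))/=.
rewrite -(pair_big xpredT xpredT (fun i j : 'I_N => \sum_(k < N) (w1 i + w2 j + w3 k) *
  r ^+ (gap i j + gap j k + gap i k)))/=.
have w0 (w : nat -> R) : (forall k, 0 <= w k <= 1) -> forall k, 0 <= w k.
  by move=> h01 k; have /andP[] := h01 k.
pose C := 2 * (2 / (1 - r)) ^+ 2.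
have b1 := sum_gap_weight_le r01 (w0 _ w1_01) (sw1 N).
have b2 := sum_gap_weight_le r01 (w0 _ w2_01) (sw2 N).
have b3 := sum_gap_weight_le r01 (w0 _ w3_01) (sw3 N).
have -> : 6 * (2 / (1 - r)) ^+ 2 = C + C + C by rewrite /C; ring.
(* The summand of [w1 i] keeps the two gaps at [i], and similarly for [w2 j] and
   [w3 k]; the third gap is dropped. *)
apply: le_trans (lerD (lerD b1 b2) b3).
rewrite [X in _ + X + _]exchange_big/=.
rewrite [X in _ + _ + X]exchange_big/=.
under [X in _ + _ + X]eq_bigr do rewrite exchange_big/=.
rewrite [X in _ + _ + X]exchange_big/=.
rewrite -!big_split /=; apply: ler_sum => i _.
rewrite -!big_split /=; apply: ler_sum => j _.
rewrite -!big_split /=; apply: ler_sum => k _.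
have drop u v : r ^+ (u + v) <= r ^+ u.
  by rewrite exprD ler_piMr ?exprn_ge0// exprn_ile1// ltW.
rewrite !mulrDl; apply: lerD; first apply: lerD; apply: ler_wpM2l => //.
- exact: w0.
- by rewrite -exprD addnAC; exact: drop.
- exact: w0.
- by rewrite -exprD (gapC j i); exact: drop.
- exact: w0.
- by rewrite -exprD -addnA addnC (gapC k i) (gapC k j); exact: drop.
Qed.

End Bounds.
End Trilinear.

(** * From norms to finite sums *)

Section SequenceSpaceBounds.
Context {R : realType} {T : choiceType}.

Lemma sum_le_esum (f : T -> R) (s : seq T) : uniq s ->
  ((\sum_(x <- s) f x)%:E <= \esum_(x in [set: T]) (f x)%:E)%E.
Proof.
move=> us; apply: ereal_sup_ubound; exists [set` s].
  by split => //; exact: finite_seq.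
by rewrite -fsbig_seq// sumEFin.
Qed.

Lemma esum_le (f : T -> R) (K : R) :
  (forall s, uniq s -> \sum_(x <- s) f x <= K) ->
  (\esum_(x in [set: T]) (f x)%:E <= K%:E)%E.
Proof.
move=> h; apply: ge_ereal_sup => _ [A [finA _] <-].
by rewrite fsbig_finite//= sumEFin lee_fin h.
Qed.

(** For finite [r] the witness is [A ^ r]; for [r = oo] the exponent [1/r]
    vanishes and any [f] will do, as [0 `^ 0 = 1]. *)
Lemma lnorm_submass (r : \bar R) (A : T -> R) : (0 < r)%E ->
  (forall x, 0 <= A x) -> lnorm r A = 1%E ->
  exists2 f, submass f & forall x, A x <= f x `^ rcp r.
Proof.
case: r => [r||]// r0 A0; last first.
  rewrite /lnorm => A1; exists (fun=> 0).
    by split => // s _; rewrite big1.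
  move=> x; rewrite /rcp invey /= powRr0 -lee_fin -A1.
  by apply: ereal_sup_ubound; exists x => //=; rewrite ger0_norm.
rewrite lte_fin in r0; rewrite /lnorm => A1.
have AE x : `|A x| = A x by rewrite ger0_norm.
exists (fun x => A x `^ r); last first.
  by move=> x; rewrite /rcp fine_invr -powRrM mulfV ?gt_eqF// powRr1.
split=> [x|s us]; first exact: powR_ge0.
rewrite -lee_fin; apply: le_trans (sum_le_esum _ us) _.
have <- : \esum_(k in [set: T]) (`|A k| `^ r)%:E = 1%E; last first.
  by apply: le_esum => x _; rewrite AE.
have E0 : (0 <= \esum_(k in [set: T]) (`|A k| `^ r)%:E)%E.
  by apply: esum_ge0 => x _; rewrite lee_fin powR_ge0.
have := poweRrM (\esum_(k in [set: T]) (`|A k| `^ r)%:E) r^-1 r.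
by rewrite mulVf ?gt_eqF// A1 poweR1r poweRe1.
Qed.

Lemma ell_plus_sum_le (q : R) (V : T -> R) : 0 < q -> ell_plus q%:E V ->
  exists K, forall s, uniq s -> \sum_(x <- s) V x `^ q <= K.
Proof.
move=> q0 [V0 /= hV].
pose E := \esum_(k in [set: T]) (`|V k| `^ q)%:E.
have E0 : (0 <= E)%E by apply: esum_ge0 => x _; rewrite lee_fin powR_ge0.
have Efin : E \is a fin_num.
  rewrite ge0_fin_numE// ltey; apply/eqP => Ey.
  by move: hV; rewrite -/E Ey poweRyr ?ltxx// invr_eq0 gt_eqF.
exists (fine E) => s us; rewrite -lee_fin fineK//.
apply: le_trans (sum_le_esum _ us) _.
by apply: le_esum => x _; rewrite ger0_norm.
Qed.

(** The weak norm bounds the smallest of finitely many values.  The weak norm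
    counts the points where [V] is strictly above a level, so the level is taken
    at half of the smallest value. *)
Lemma weak_ell_plus_min_le (q : R) (V : T -> R) : 0 < q -> weak_ell_plus q V ->
  exists2 M, 0 <= M & forall E x, uniq E -> x \in E ->
    {in E, forall y, V x <= V y} -> V x * (size E)%:R `^ q^-1 <= M.
Proof.
move=> q0 [V0 hV].
have W0 : (0 <= weak_lnorm q V)%E.
  apply: le_trans (ereal_sup_ubound _); last by exists 1; [exact: ltr01|].
  by rewrite mul1e poweR_ge0.
have Wfin : weak_lnorm q V \is a fin_num by rewrite ge0_fin_numE.
have M0 : 0 <= 2 * fine (weak_lnorm q V) by rewrite mulr_ge0// fine_ge0.
exists (2 * fine (weak_lnorm q V)) => // E x uE xE hx.
have := V0 x; rewrite le_eqVlt => /predU1P[<-|Vx]; first by rewrite mul0r.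
pose t := V x / 2.
have t0 : 0 < t by rewrite divr_gt0.
have W : (t%:E * poweR (counting [set k | (t < `|V k|)%R]) q^-1 <=
    weak_lnorm q V)%E by apply: ereal_sup_ubound; exists t.
have iq0 : 0 < q^-1 by rewrite invr_gt0.
move: W; rewrite /counting; case: ifPn => [/asboolP fin|_]; last first.
  rewrite poweRyr ?gt_eqF// gt0_muley ?lte_fin// leye_eq => /eqP Wy.
  by rewrite Wy in Wfin.
rewrite -[weak_lnorm q V]fineK// poweR_EFin -EFinM lee_fin => W.
rewrite -[V x](@divfK _ 2)// -/t mulrAC [leRHS]mulrC ler_pM2r//.
apply: le_trans W; rewrite ler_pM2l//; apply: (ge0_ler_powR (ltW iq0)); rewrite ?nnegrE//.
rewrite ler_nat; apply: uniq_leq_size => // y yE; rewrite in_fset_set// inE /= ger0_norm//.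
by apply: lt_le_trans (hx _ yE); rewrite /t ltr_pdivrMr//; lra.
Qed.

End SequenceSpaceBounds.

(** Membership in the form class follows from a uniform bound on finite sums. *)
Lemma B_form_of_finite_sums (R : realType) (n : nat) (q1 q2 q3 : \bar R)
    (V : Zn n * Zn n -> R) (K : R) :
  (0 < q1)%E -> (0 < q2)%E -> (0 < q3)%E -> (forall z, 0 <= V z) ->
  (forall (f g h : Zn n -> R) (X : seq (Zn n * Zn n)),
     submass f -> submass g -> submass h -> uniq X ->
     \sum_(z <- X) V z * (f z.1 `^ rcp q1 * g z.2 `^ rcp q2 *
       h (z.1 + z.2) `^ rcp q3) <= K) ->
  B_form q1 q2 q3 V.
Proof.
move=> q10 q20 q30 V0 hK; split => //.
apply: (@le_lt_trans _ _ K%:E); last exact: ltry.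
apply: ge_ereal_sup => _ [A [B [C [[A0 B0 C0] [[A1 B1 C1] ->]]]]].
have [f fm Af] := lnorm_submass q10 A0 A1.
have [g gm Bg] := lnorm_submass q20 B0 B1.
have [h hm Ch] := lnorm_submass q30 C0 C1.
apply: esum_le => X uX; apply: le_trans (hK _ _ _ _ fm gm hm uX).
apply: ler_sum => z _; rewrite -!mulrA ler_wpM2l//.
by rewrite !ler_pM ?mulr_ge0.
Qed.

(** * Arithmetic of the exponents *)

Section ExponentArithmetic.
Context {R : realType}.
Implicit Types (p : \bar R) (P : 'I_3 -> \bar R) (q : R).

Local Notation o0 := (@inord 2 0).
Local Notation o1 := (@inord 2 1).
Local Notation o2 := (@inord 2 2).

(** The number [min (1/2, 1 - 1/p)], that is the reciprocal of [max (2, p')]. *)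
Definition corcp p : R := Num.min 2^-1 (1 - rcp p).

Lemma corcp_lo p : rcp p <= 2^-1 -> corcp p = 2^-1.
Proof. by move=> h; rewrite /corcp min_l//; lra. Qed.

Lemma corcp_hi p : 2^-1 <= rcp p -> corcp p = 1 - rcp p.
Proof. by move=> h; rewrite /corcp min_r//; lra. Qed.

Lemma corcp_itv p : (1 <= p)%E -> 0 <= corcp p <= 2^-1.
Proof.
by move=> /rcp_itv /andP[_ h]; rewrite /corcp le_min ge_min lexx/= andbT; lra.
Qed.

Lemma rcpy : rcp (+oo%E : \bar R) = 0.
Proof. by rewrite /rcp invey. Qed.

Lemma rcp_EFin (x : R) : rcp x%:E = x^-1.
Proof. by rewrite /rcp fine_invr. Qed.

Lemma rcp_hoelder_conjugate p : (1 <= p)%E -> rcp (hoelder_conjugate p) = 1 - rcp p.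
Proof.
case: p => [r||]//; last first.
  by rewrite hoelder_conjugatey rcpy rcp_EFin invr1 subr0.
rewrite lee_fin => r1; have r0 : r != 0 by rewrite gt_eqF//; lra.
have := @hoelder_conjugate_eq1 R r%:E (ltNyr r).
rewrite eqe => /(_ r0) /(congr1 fine) /=.
have : (1 <= hoelder_conjugate r%:E)%E by apply: hoelder_conj_ge1; rewrite lee_fin.
case: (hoelder_conjugate r%:E) => [t||]//; last first.
  by rewrite invey adde0 rcpy -/(rcp r%:E) => _ /= ->; rewrite subrr.
rewrite lee_fin => t1; have t0 : t != 0 by rewrite gt_eqF//; lra.
by rewrite !inver (negbTE r0) (negbTE t0)/= !rcp_EFin => <-; rewrite addrC addrK.
Qed.

Lemma rcp_max2 p : (0 < p)%E -> rcp (maxe 2%:E p) = Num.min 2^-1 (rcp p).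
Proof.
case: p => [r||]//; last first.
  by move=> _; rewrite maxey rcpy min_r.
rewrite lte_fin => r0; rewrite -EFin_max !rcp_EFin.
have [h|h] := leP r 2.
  by rewrite min_l// lef_pV2// posrE.
by rewrite min_r// lef_pV2// ?posrE// ltW.
Qed.

Lemma rcp_max2_conjugate p : (1 <= p)%E ->
  rcp (maxe 2%:E (hoelder_conjugate p)) = corcp p.
Proof.
move=> p1; rewrite rcp_max2 ?rcp_hoelder_conjugate//.
exact: lt_le_trans (hoelder_conj_ge1 p1).
Qed.

Lemma rcp_max2_third p : (0 < p)%E ->
  rcp (maxe 2%:E p) = corcp (third_exponent p).
Proof.
move=> p0; rewrite rcp_max2// /third_exponent; case: ifPn => [p1|].
  rewrite corcp_lo ?rcpy// min_l//.
  case: p p0 p1 => [r||]//; rewrite lte_fin lee_fin rcp_EFin => r0 r1.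
  by rewrite lef_pV2 ?posrE//; lra.
by rewrite -ltNge => /ltW p1; rewrite /corcp rcp_hoelder_conjugate// opprB addrC subrK.
Qed.

(** The reciprocal of [q] is the largest of four linear expressions in the
    [max (1/2, 1/p_i)], namely those for which the inequalities on [1 - 1/q] below become
    equalities. *)
Lemma exponent_bounds P q : (forall i, 1 <= P i)%E -> exponent P q ->
  [/\ 0 < q^-1 <= 1,
      [/\ 1 - q^-1 <= corcp (P o0) + corcp (P o1),
          1 - q^-1 <= corcp (P o1) + corcp (P o2)
        & 1 - q^-1 <= corcp (P o0) + corcp (P o2)]
    & 2 * (1 - q^-1) <= corcp (P o0) + corcp (P o1) + corcp (P o2)].
Proof.
move=> P1 hq.
pose a i := corcp (P i).
have a01 i : 0 <= a i <= 2^-1 by exact: corcp_itv.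
pose c i j k := [/\ 0 < q^-1 <= 1,
  [/\ 1 - q^-1 <= a i + a j, 1 - q^-1 <= a j + a k & 1 - q^-1 <= a i + a k]
  & 2 * (1 - q^-1) <= a i + a j + a k].
have sym i j k : uniq [:: i; j; k] -> c i j k -> c o0 o1 o2.
  move=> u [q0 [h1 h2 h3] h4].
  by case: (uniq3 u) => [[? ? ?]|[? ? ?]|[[? ? ?]|[? ? ?]|[[? ? ?]|[? ? ?]]]];
    subst i j k; (split; [exact: q0|split|]); lra.
suff : c o0 o1 o2 by [].
have [y _ _ _] := uniq_perms.
have lo i : rcp (P i) <= 2^-1 -> a i = 2^-1 by exact: corcp_lo.
have hi i : 2^-1 <= rcp (P i) -> a i = 1 - rcp (P i) by exact: corcp_hi.
case: hq => [h hq|i j k u h1 h2 h3 hq|i j k u h1 h2 h3 h hq|i j k u h1 h2 h3 h hq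
       |h t hq|i j k u h t hq].
- rewrite /c hq !(lo _ (h _)); split; [|split|]; lra.
- have {}hq : q^-1 = 2^-1 * rcp (P k).
    move: hq; rewrite [P k in X in X -> _]rcp_gt0; last by lra.
    by rewrite -EFinM => -[->]; rewrite invfM invrK.
  apply: (sym _ _ _ u); have := a01 k; rewrite /c (lo _ h1) (lo _ h2) (hi _ h3) => ?.
  by split; [|split|]; lra.
- apply: (sym _ _ _ u); have := a01 j; have := a01 k.
  rewrite /c (lo _ h1) (hi _ h2) (hi _ h3) => ? ?.
  by split; [|split|]; lra.
- apply: (sym _ _ _ u); have := a01 j; have := a01 k.
  rewrite /c (lo _ h1) (hi _ h2) (hi _ h3) => ? ?.
  by split; [|split|]; lra.
- have [u1 u2 _ [u4 _ _]] := uniq_perms; rewrite sum3 in hq.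
  have t1 := t _ _ _ u1; have t2 := t _ _ _ u2; have t3 := t _ _ _ u4.
  have := a01 o0; have := a01 o1; have := a01 o2.
  rewrite /c !(hi _ (h _)) => ? ? ?.
  by split; [|split|]; lra.
- apply: (sym _ _ _ u); have := a01 i; have := a01 j; have := a01 k.
  rewrite /c !(hi _ (h _)) => ? ? ?.
  by split; [|split|]; lra.
Qed.

Lemma weak_case_bounds P : (forall i, 1 <= P i)%E -> weak_case P ->
  [/\ corcp (P o0) < corcp (P o1) + corcp (P o2),
      corcp (P o1) < corcp (P o0) + corcp (P o2),
      corcp (P o2) < corcp (P o0) + corcp (P o1)
    & 1 <= corcp (P o0) + corcp (P o1) + corcp (P o2)].
Proof.
move=> P1 hw.
pose a i := corcp (P i).
have a01 i : 0 <= a i <= 2^-1 by exact: corcp_itv.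
pose c i j k := [/\ a i < a j + a k, a j < a i + a k, a k < a i + a j
  & 1 <= a i + a j + a k].
have sym i j k : uniq [:: i; j; k] -> c i j k -> c o0 o1 o2.
  move=> u [h1 h2 h3 h4].
  by case: (uniq3 u) => [[? ? ?]|[? ? ?]|[[? ? ?]|[? ? ?]|[[? ? ?]|[? ? ?]]]];
    subst i j k; split; lra.
suff : c o0 o1 o2 by [].
have lo i : rcp (P i) <= 2^-1 -> a i = 2^-1 by exact: corcp_lo.
have hi i : 2^-1 <= rcp (P i) -> a i = 1 - rcp (P i) by exact: corcp_hi.
case: hw => [h|i j k u h1 h2 h3 h|i j k u h1 h2 h3 h|h t hs].
- by rewrite /c !(lo _ (h _)); split; lra.
- apply: (sym _ _ _ u); have := a01 k; rewrite /c (lo _ h1) (lo _ h2) (hi _ h3) => ?.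
  by split; lra.
- apply: (sym _ _ _ u); have := a01 j; have := a01 k.
  rewrite /c (lo _ h1) (hi _ h2) (hi _ h3) => ? ?.
  by split; lra.
- have [u1 u2 _ [u4 _ _]] := uniq_perms; rewrite sum3 in hs.
  have t1 := t _ _ _ u1; have t2 := t _ _ _ u2; have t3 := t _ _ _ u4.
  by rewrite /c !(hi _ (h _)); split; lra.
Qed.

End ExponentArithmetic.

(** * The inclusions *)

Lemma pair_fst_snd_inj (U W : Type) :
  injective (fun z : U * W => (z.1, z.2)).
Proof. by move=> [? ?] [? ?]. Qed.

Lemma pair_snd_add_inj (G : zmodType) :
  injective (fun z : G * G => (z.2, z.1 + z.2)).
Proof. by move=> [x y] [x' y'] /= [-> /addIr ->]. Qed.

Lemma pair_fst_add_inj (G : zmodType) :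
  injective (fun z : G * G => (z.1, z.1 + z.2)).
Proof. by move=> [x y] [x' y'] /= [-> /addrI ->]. Qed.

Theorem proposition1p5 (R : realType) (n : nat) (p1 p2 p : \bar R) (q : R)
    (hp1 : (1 <= p1)%E) (hp2 : (1 <= p2)%E) (hp : (0 < p)%E)
    (hq : exponent (exponents p1 p2 p) q) :
  (@ell_plus R (Zn n * Zn n)%type q%:E `<=`
     B_form (maxe 2%:E (hoelder_conjugate p1)) (maxe 2%:E (hoelder_conjugate p2))
            (maxe 2%:E p)) /\
  (weak_case (exponents p1 p2 p) ->
   @weak_ell_plus R (Zn n * Zn n)%type q `<=`
     B_form (maxe 2%:E (hoelder_conjugate p1)) (maxe 2%:E (hoelder_conjugate p2))
            (maxe 2%:E p)).
Proof.
have P1 i : (1 <= exponents p1 p2 p i)%E by exact: exponents_ge1.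
have E0 : exponents p1 p2 p (inord 0) = p1.
  by rewrite /exponents (tnth_nth 1%E) /= inordK.
have E1 : exponents p1 p2 p (inord 1) = p2.
  by rewrite /exponents (tnth_nth 1%E) /= inordK.
have E2 : exponents p1 p2 p (inord 2) = third_exponent p.
  by rewrite /exponents (tnth_nth 1%E) /= inordK.
have max2_gt0 r : (0 < maxe 2%:E r :> \bar R)%E.
  by apply: lt_le_trans (_ : 2%:E <= _)%E; rewrite ?lte_fin ?le_max ?lexx.
have ex r : (1 <= r :> \bar R)%E -> 0 <= corcp r by move=> /corcp_itv/andP[].
have [/andP[iq0 iq1]] := exponent_bounds P1 hq; rewrite E0 E1 E2 => -[b12 b23 b13] b.
have q0 : 0 < q by rewrite -invr_gt0.
have q1 : 1 <= q by rewrite -invf_le1.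
have a0 := ex _ hp1; have b0 := ex _ hp2.
have c0 : 0 <= corcp (third_exponent p) by rewrite -E2; exact: ex.
have i12 := @pair_fst_snd_inj (Zn n) (Zn n).
have i23 := @pair_snd_add_inj (Zn n); have i13 := @pair_fst_add_inj (Zn n).
split=> [V hV|hw V hV]; have V0 := hV.1.
  have [K hK] := ell_plus_sum_le q0 hV.
  apply: (B_form_of_finite_sums (K := K + 3)) => // f g h X fm gm hm uX.
  rewrite !rcp_max2_conjugate// rcp_max2_third//.
  apply: le_trans (strong_trilinear_le i12 i23 i13 fm gm hm V0 q1 a0 b0 c0
    b12 b23 b13 b uX) _.
  by rewrite lerD2r hK.
have := weak_case_bounds P1 hw; rewrite E0 E1 E2 => -[t1 t2 t3 t].
set a := corcp p1 in a0 t1 t2 t3 t b b12 b23 b13.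
set a' := corcp p2 in b0 t1 t2 t3 t b b12 b23 b13.
set a'' := corcp (third_exponent p) in c0 t1 t2 t3 t b b12 b23 b13.
pose s := (a + a' + a'') / 2.
(* The rate of decay of the kernel; positive by the strict triangle
   inequalities. *)
pose d := Num.min (s - a) (Num.min (s - a') (s - a'')).
have d0 : 0 < d by rewrite !lt_min /s; apply/and3P; split; lra.
have [d1 d2 d3] : [/\ d <= s - a, d <= s - a' & d <= s - a''].
  by rewrite /d; split; rewrite !ge_min lexx ?orbT.
have s01 : 0 < s <= 1.
  have /andP[_ h1] := corcp_itv hp1; have /andP[_ h2] := corcp_itv hp2.
  have /andP[_] := corcp_itv (P1 (inord 2)); rewrite E2 => h3.
  rewrite -/a in h1; rewrite -/a' in h2; rewrite -/a'' in h3.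
  by rewrite /s; apply/andP; split; lra.
have [M M0 hM] := weak_ell_plus_min_le q0 hV.
have VK : forall E, uniq E -> \sum_(z <- E) V z <= M / s * (size E)%:R `^ s.
  apply: weak_sum_le => // E x uE xE hx; apply: le_trans (hM E x uE xE hx).
  rewrite ler_wpM2l//; apply: ler_powR; last by rewrite /s; lra.
  by rewrite ler1n; case: (E) xE.
have Ms0 : 0 <= M / s by rewrite divr_ge0//; lra.
apply: (B_form_of_finite_sums
  (K := M / s * (6 * (2 / (1 - 2 `^ (- (d / 2)))) ^+ 2))) => // f g h X fm gm hm uX.
have sE : a + a' + a'' = 2 * s by rewrite /s; lra.
rewrite !rcp_max2_conjugate// rcp_max2_third//.
by apply: (weak_trilinear_le i12 i23 i13 fm gm hm Ms0 V0 VK) => //;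
  rewrite -/a -/a' -/a''; lra.
Qed.
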